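(* If there exist a polynomial $P$ and an algorithm which, given an integer $n\ge0$, outputs in time $P(n)$ a join/union expression over the sets $([n],[n])$ whose semantics is exactly the set $\mathfrak C_n$ of $n$-cycles of the symmetric group $\mathfrak S_n$ (viewed as functions $[n]\to[n]$), then $\mathsf P=\mathsf{NP}$.
   Context: An $n$-cycle is a permutation $\sigma$ of $[n]=\{1,\dots,n\}$ of the form $(a_1\,a_2\cdots a_n)$, i.e. mapping $a_1\mapsto a_2\mapsto\cdots\mapsto a_n\mapsto a_1$ for pairwise distinct $a_i$. Join/union expressions over finite sets $(S,T)$ are generated by the grammar $E ::= \emptyset \mid T^{\emptyset} \mid (s\mapsto t) \mid E\uplus E \mid E\Join E$ with $(s,t)\in S\times T$; $dom(E)$ is the set of $s$ such that some leaf of $E$ is $(s\mapsto t)$. The semantics $[E]$ is either FAIL or a subset of $T^{dom(E)}$: $[\emptyset]=\emptyset$; $[T^\emptyset]=T^\emptyset$; $[s\mapsto t]=\{(s\mapsto t)\}$; $[E_1\uplus E_2]$ is FAIL if either $[E_i]$ is FAIL, else $[E_1]$ if $[E_2]=\emptyset$, else $[E_2]$ if $[E_1]=\emptyset$, else FAIL if $dom(E_1)\neq dom(E_2)$ or $[E_1]\cap[E_2]\ne\emptyset$, else $[E_1]\cup[E_2]$; $[E_1\Join E_2]$ is FAIL if either $[E_i]$ is FAIL or $dom(E_1)\cap dom(E_2)\neq\emptyset$, else $\{f_1\Join f_2: f_i\in[E_i]\}$, where $f_1\Join f_2$ is the function on the disjoint union of the domains agreeing with $f_1$ and $f_2$.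 *)

(* Defs.v *)
From HB Require Import structures.
From mathcomp Require Import all_boot all_algebra all_fingroup.

Set Implicit Arguments.
Unset Strict Implicit.
Unset Printing Implicit Defensive.

Section JoinUnion.
Variables S T : finType.

Inductive juexpr : Type :=
  | JUempty                      (* the expression $\emptyset$ *)
  | JUunit                       (* the expression $T^\emptyset$ *)
  | JUmap of S & T
  | JUunion of juexpr & juexpr
  | JUjoin of juexpr & juexpr.

Fixpoint dom (E : juexpr) : {set S} :=
  match E with
  | JUempty | JUunit => set0
  | JUmap s _ => [set s]
  | JUunion E1 E2 | JUjoin E1 E2 => dom E1 :|: dom E2
  end.

(* A function from a subset D of S to T is the total map S -> option T equal  *)
(* to None exactly outside D. A single type for all domains is needed: if     *)
(* [E2] is empty then [E1 (+) E2] = [E1] consists of functions on dom E1,     *)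
(* even when dom E2 is not contained in dom E1.                               *)
Definition pfun := {ffun S -> option T}.

Definition pfun0 : pfun := [ffun=> None].

Definition pfun1 (s : S) (t : T) : pfun :=
  [ffun x => if x == s then Some t else None].

Definition pjoin (f g : pfun) : pfun :=
  [ffun x => if f x is Some t then Some t else g x].

(* None is FAIL. *)
Fixpoint sem (E : juexpr) : option {set pfun} :=
  match E with
  | JUempty => Some set0
  | JUunit => Some [set pfun0]
  | JUmap s t => Some [set pfun1 s t]
  | JUunion E1 E2 =>
      match sem E1, sem E2 with
      | Some A1, Some A2 =>
          if A2 == set0 then Some A1
          else if A1 == set0 then Some A2
          else if (dom E1 != dom E2) || (A1 :&: A2 != set0) then None
          else Some (A1 :|: A2)
      | _, _ => None
      end
  | JUjoin E1 E2 =>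
      match sem E1, sem E2 with
      | Some A1, Some A2 =>
          if dom E1 :&: dom E2 != set0 then None
          else Some [set pjoin f1 f2 | f1 in A1, f2 in A2]
      | _, _ => None
      end
  end.

End JoinUnion.

Arguments JUempty {S T}.
Arguments JUunit {S T}.

(* Here [n] is 'I_n = {0, ..., n-1}. *)
Definition is_ncycle (n : nat) (s : 'S_n) : bool :=
  [exists a : n.-tuple 'I_n, uniq a && fcycle s a].

Definition ncycles (n : nat) : {set pfun 'I_n 'I_n} :=
  [set [ffun i => Some (s i)] | s : 'S_n & is_ncycle s].

(* Deterministic Turing machines with one two-way infinite tape and           *)
(* input/output alphabet A.                                                   *)
Inductive direction := MoveLeft | MoveStay | MoveRight.

(* None is the blank symbol. *)
Definition tape_symbol (A W : finType) : Type := option (A + W).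

(* The machine halts when tm_delta returns None. *)
Record tm (A : finType) := TM {
  tm_state : finType;
  tm_work : finType;
  tm_start : tm_state;
  tm_accept : pred tm_state;
  tm_delta : tm_state -> tape_symbol A tm_work ->
    option (tm_state * tape_symbol A tm_work * direction)
}.

Section Run.
Variables (A : finType) (M : tm A).

Notation symbol := (tape_symbol A (tm_work M)).

(* cfg_left lists the cells to the left of the head, nearest first; cells     *)
(* that are listed neither in cfg_left nor in cfg_right are blank.            *)
Record config := Config {
  cfg_state : tm_state M;
  cfg_left : seq symbol;
  cfg_head : symbol;
  cfg_right : seq symbol
}.

Definition mk_config (q : tm_state M) (l r : seq symbol) : config :=
  Config q l (head None r) (behead r).

Definition init (x : seq A) : config :=
  mk_config (tm_start M) [::] [seq Some (inl a) | a <- x].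

Definition step (c : config) : option config :=
  if tm_delta (cfg_state c) (cfg_head c) is Some (q, b, d) then
    let l := cfg_left c in
    let r := cfg_right c in
    Some (match d with
          | MoveLeft => mk_config q (behead l) [:: head None l, b & r]
          | MoveStay => mk_config q l (b :: r)
          | MoveRight => mk_config q (b :: l) r
          end)
  else None.

(* run t c is the halting configuration reached from c if the machine halts   *)
(* after at most t steps, and None otherwise.                                 *)
Fixpoint run (t : nat) (c : config) : option config :=
  match step c with
  | None => Some c
  | Some c' => if t is t'.+1 then run t' c' else None
  end.

Fixpoint io_prefix (s : seq symbol) : seq A :=
  if s is Some (inl a) :: s' then a :: io_prefix s' else [::].

(* The longest word over A that starts at the head. *)
Definition output (c : config) : seq A :=
  io_prefix (cfg_head c :: cfg_right c).

Definition accepting (c : config) : bool := tm_accept (cfg_state c).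

End Run.

Definition language (A : finType) := seq A -> Prop.

Definition class_P (A : finType) (L : language A) : Prop :=
  exists (M : tm A) (p : {poly nat}), forall x : seq A,
    exists2 c, run p.[size x]%R (init M x) = Some c & (accepting c <-> L x).

Definition word_pair (x w : seq bool) : seq (option bool) :=
  [seq Some b | b <- x] ++ None :: [seq Some b | b <- w].

Definition class_NP (L : language bool) : Prop :=
  exists (V : language (option bool)) (q : {poly nat}),
    class_P V /\
    forall x : seq bool,
      L x <-> exists2 w : seq bool, size w <= q.[size x]%R & V (word_pair x w).

Definition P_eq_NP : Prop :=
  forall L : language bool, class_P L <-> class_NP L.

(* Integers are written in unary, since time is measured against the value n; *)
(* expressions are written in prefix notation with 3-bit operator codes and   *)
(* self-delimiting unary labels.                                              *)
Definition unary (n : nat) : seq bool := nseq n true.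

Definition encode_ord (n : nat) (i : 'I_n) : seq bool := rcons (unary i) false.

Fixpoint encode (n : nat) (E : juexpr 'I_n 'I_n) : seq bool :=
  match E with
  | JUempty => [:: false; false; false]
  | JUunit => [:: false; false; true]
  | JUmap s t => [:: false; true; false] ++ encode_ord s ++ encode_ord t
  | JUunion E1 E2 => [:: false; true; true] ++ encode E1 ++ encode E2
  | JUjoin E1 E2 => [:: true; false; false] ++ encode E1 ++ encode E2
  end.

(* Main.v *)
(* The hypothesis is contradictory, so P = NP follows vacuously: every
   join/union expression for the n-cycles has exponential size. Read from the
   root down, each subexpression that contributes to the result denotes a set A
   of bijections between two fixed d-element sets, and induction on the
   expression gives [#|A| * 2 ^ d <= 2 * leaves * d!]. There are at least
   [n! / n] n-cycles, hence at least [2 ^ n / (2 * n)] leaves, whereas a machine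
   running in polynomial time only writes polynomially many symbols. *)
Require Import Defs.
From mathcomp Require Import all_boot all_algebra all_fingroup zify.

Set Implicit Arguments.
Unset Strict Implicit.
Unset Printing Implicit Defensive.

(** * Lower bound on the number of leaves of an expression *)

(** Amounts to [binomial (m + k) k >= 2 ^ k]: raising [k] by one multiplies the left side by
    [2 * k.+1] and the right side by [(m + k).+1], which is at least as large. *)
Lemma fact_add_exp2 m k : k <= m -> m`! * k`! * 2 ^ k <= (m + k)`!.
Proof.
elim: k => [|k IHk] lt_km; first by rewrite addn0 !muln1.
have {IHk} := IHk (ltnW lt_km); rewrite addnS !factS expnS => IHk.
have le2 : 2 * k.+1 <= (m + k).+1 by lia.
by apply: leq_trans (leq_mul le2 IHk); rewrite mulnACA [2 * _]mulnC; lia.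
Qed.

Section LowerBound.
Variables S T : finType.
Implicit Types (E : juexpr S T) (f g : pfun S T) (A : {set pfun S T}).
Implicit Types (D : {set S}) (R : {set option T}).

Fixpoint leaves E : nat :=
  match E with
  | JUunion E1 E2 | JUjoin E1 E2 => leaves E1 + leaves E2
  | _ => 1
  end.

Definition psupp f : {set S} := [set x | f x != None].

(** Injectivity is expressed by cardinalities, so that joins can be treated by counting images. *)
Definition pbij D R f : bool :=
  [&& psupp f == D, f @: D == R & #|R| == #|D|].

(** Each [f] is [None] off [D], so restriction to [D] embeds [A] into the injections from [D] to a
    set of the same size. *)
Lemma card_pbij D R A : {in A, forall f, pbij D R f} -> #|A| <= #|D|`!.
Proof.
move=> bijA; pose D' := {x | x \in D}.
have cardD' : #|{: D'}| = #|D| by rewrite card_sig; apply: eq_card.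
have [->|[f0 /bijA /and3P[_ _ /eqP cardR]]] := set_0Vmem A; first by rewrite cards0.
pose r f : {ffun D' -> option T} := [ffun x => f (val x)].
have injr : {in A &, injective r}.
  move=> f g /bijA/and3P[/eqP sf _ _] /bijA/and3P[/eqP sg _ _] eq_r.
  apply/ffunP => x; have [xD|xD] := boolP (x \in D).
    by have /ffunP/(_ (exist _ x xD)) := eq_r; rewrite !ffunE.
  have := xD; rewrite -{1}sf inE negbK => /eqP->.
  by have := xD; rewrite -sg inE negbK => /eqP->.
rewrite -(card_in_imset injr) -ffactnn -{1}cardR -cardD' -card_inj_ffuns_on.
apply/subset_leq_card/subsetP => _ /imsetP[f /bijA/and3P[_ /eqP fD /eqP eqRD] ->].
rewrite inE; apply/andP; split.
  by apply/ffun_onP => x; rewrite ffunE -fD imset_f // (valP x).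
apply/injectiveP => x y; rewrite !ffunE => fxy; apply: val_inj.
have /imset_injP injf : #|f @: D| == #|D| by rewrite fD eqRD.
by apply: injf fxy; apply: valP.
Qed.

(** Equality can fail: a union with an empty operand still counts the labels of that operand. *)
Lemma psupp_sub_dom E A f : sem E = Some A -> f \in A -> psupp f \subset Defs.dom E.
Proof.
elim: E A f => [||s t|E1 IH1 E2 IH2|E1 IH1 E2 IH2] A f /=.
- by case=> <-; rewrite inE.
- case=> <-; rewrite inE => /eqP->.
  by apply/subsetP=> x; rewrite !inE ffunE.
- case=> <-; rewrite inE => /eqP->.
  by apply/subsetP=> x; rewrite !inE ffunE; case: (x == s).
- case: (sem E1) IH1 => // A1 IH1; case: (sem E2) IH2 => // A2 IH2.
  have sub1 g : g \in A1 -> psupp g \subset Defs.dom E1 :|: Defs.dom E2.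
    by move=> gA; apply: subset_trans (subsetUl _ _); apply: IH1 gA.
  have sub2 g : g \in A2 -> psupp g \subset Defs.dom E1 :|: Defs.dom E2.
    by move=> gA; apply: subset_trans (subsetUr _ _); apply: IH2 gA.
  case: ifP => _; first by case=> <-; apply: sub1.
  case: ifP => _; first by case=> <-; apply: sub2.
  by case: ifP => // _ [<-]; rewrite inE => /orP[/sub1|/sub2].
- case: (sem E1) IH1 => // A1 IH1; case: (sem E2) IH2 => // A2 IH2.
  case: ifP => // _ [<-] /imset2P[f1 f2 f1A f2A ->].
  have /subsetP s1 := IH1 _ _ erefl f1A; have /subsetP s2 := IH2 _ _ erefl f2A.
  apply/subsetP => x; rewrite !inE ffunE.
  have := s1 x; have := s2 x; rewrite !inE.
  by case: (f1 x) => [t _ ->//|H _ /H ->]; rewrite ?orbT.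
Qed.

(** The images of the two parts cover [R], while their sizes add up to at most [#|D| = #|R|]; hence
    they are disjoint and each part is injective. Given [D] and [R], the target of [f1] depends on
    [f2] alone, and vice versa. *)
Lemma pbij_join D R D1 D2 f1 f2 : [disjoint D1 & D2] ->
  psupp f1 \subset D1 -> psupp f2 \subset D2 -> pbij D R (pjoin f1 f2) ->
  [/\ pbij (D :&: D1) (R :\: f2 @: (D :&: D2)) f1,
      pbij (D :&: D2) (R :\: f1 @: (D :&: D1)) f2
    & #|D :&: D1| + #|D :&: D2| = #|D|].
Proof.
move=> dis s1 s2 /and3P[/eqP sD /eqP imD /eqP cardR].
have f2D1 x : x \in D1 -> f2 x = None.
  move=> xD1; apply/eqP; apply: contraT => Hx.
  have /(subsetP s2) xD2 : x \in psupp f2 by rewrite inE.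
  by rewrite (disjointFr dis xD1) in xD2.
have f1D2 x : x \in D2 -> f1 x = None.
  move=> xD2; apply/eqP; apply: contraT => Hx.
  have /(subsetP s1) xD1 : x \in psupp f1 by rewrite inE.
  by rewrite (disjointFl dis xD2) in xD1.
have sD1 : psupp f1 = D :&: D1.
  apply/setP => x; rewrite -sD !inE ffunE.
  have [xD1|xD1] := boolP (x \in D1).
    by rewrite andbT (f2D1 _ xD1); case: (f1 x).
  rewrite andbF; apply/negbTE; apply: contra xD1 => Hx.
  by apply: (subsetP s1); rewrite inE.
have sD2 : psupp f2 = D :&: D2.
  apply/setP => x; rewrite -sD !inE ffunE.
  have [xD2|xD2] := boolP (x \in D2); first by rewrite andbT (f1D2 _ xD2).
  rewrite andbF; apply/negbTE; apply: contra xD2 => Hx.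
  by apply: (subsetP s2); rewrite inE.
have defD : D = (D :&: D1) :|: (D :&: D2).
  rewrite -sD1 -sD2 -sD; apply/setP => x; rewrite !inE ffunE.
  by case: (f1 x).
have cardD : #|D :&: D1| + #|D :&: D2| = #|D|.
  rewrite [in RHS]defD cardsU.
  suff -> : D :&: D1 :&: (D :&: D2) = set0 by rewrite cards0 subn0.
  by rewrite setIACA (eqP (_ : D1 :&: D2 == set0)) ?setI0 // setI_eq0.
have im1 : pjoin f1 f2 @: (D :&: D1) = f1 @: (D :&: D1).
  apply: eq_in_imset => x /setIP[_ xD1]; rewrite ffunE (f2D1 _ xD1).
  by case: (f1 x).
have im2 : pjoin f1 f2 @: (D :&: D2) = f2 @: (D :&: D2).
  by apply: eq_in_imset => x /setIP[_ xD2]; rewrite ffunE (f1D2 _ xD2).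
set R1 := f1 @: (D :&: D1) in im1 *; set R2 := f2 @: (D :&: D2) in im2 *.
have defR : R = R1 :|: R2 by rewrite -imD defD imsetU im1 im2.
have le1 : #|R1| <= #|D :&: D1| by apply: leq_imset_card.
have le2 : #|R2| <= #|D :&: D2| by apply: leq_imset_card.
have := cardsUI R1 R2; rewrite -defR cardR => cU.
have dR : R1 :&: R2 = set0 by apply/eqP; rewrite -cards_eq0; lia.
have {cU} := cU; rewrite dR cards0 addn0 => cU.
have defR1 : R :\: R2 = R1.
  by rewrite defR setDUl setDv setU0; apply/setDidPl; rewrite -setI_eq0 dR.
have defR2 : R :\: R1 = R2.
  by rewrite defR setDUl setDv set0U; apply/setDidPl; rewrite -setI_eq0 setIC dR.
have c1 : #|R1| = #|D :&: D1| by lia.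
have c2 : #|R2| = #|D :&: D2| by lia.
by split; rewrite // /pbij ?sD1 ?sD2 ?defR1 ?defR2 !eqxx /=; apply/eqP.
Qed.

(* At a join only the part with the larger domain is bounded by induction; for
   the smaller one the trivial bound [d2!] suffices, because
   [binomial (d1 + d2) d2 >= 2 ^ d2] when [d2 <= d1]. *)
Lemma card_sem_pbij E A D R : sem E = Some A -> {in A, forall f, pbij D R f} ->
  #|A| * 2 ^ #|D| <= 2 * leaves E * #|D|`!.
Proof.
elim: E A D R => [||s t|E1 IH1 E2 IH2|E1 IH1 E2 IH2] A D R /=.
- by case=> <-; rewrite cards0.
- case=> <- /(_ _ (set11 _))/and3P[/eqP<- _ _].
  by rewrite (_ : psupp _ = set0) ?cards0 ?cards1 //; apply/setP=> x; rewrite !inE ffunE.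
(* Here [#|D| = 1] and both sides equal 2; this leaf accounts for the factor 2 in the bound. *)
- case=> <- /(_ _ (set11 _))/and3P[/eqP<- _ _].
  rewrite (_ : psupp _ = [set s]) ?cards1 //.
  by apply/setP=> x; rewrite !inE ffunE; case: (x == s).
- case: (sem E1) IH1 => // A1 IH1; case: (sem E2) IH2 => // A2 IH2 semE bijA.
  have [s1 s2 cA] : [/\ A1 \subset A, A2 \subset A & #|A| <= #|A1| + #|A2|].
    case: ifP semE => [/eqP-> [<-]|_]; first by rewrite sub0set cards0 addn0.
    case: ifP => [/eqP-> [<-]|_]; first by rewrite sub0set cards0.
    case: ifP => // _ [<-]; rewrite subsetUl subsetUr; split=> //.
    by rewrite cardsU leq_subr.
  have {IH1} := IH1 _ D R erefl (fun f fA => bijA f (subsetP s1 f fA)).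
  have {IH2} := IH2 _ D R erefl (fun f fA => bijA f (subsetP s2 f fA)).
  move=> b2 b1; apply: leq_trans (leq_mul cA (leqnn _)) _.
  by rewrite mulnDl mulnDr mulnDl leq_add.
- case sE1: (sem E1) IH1 => [A1|] // IH1; case sE2: (sem E2) IH2 => [A2|] // IH2.
  case: ifP => // /negbFE dis [<-] bijA.
  rewrite setI_eq0 in dis.
  have cJ : #|[set pjoin f1 f2 | f1 in A1, f2 in A2]| <= #|A1| * #|A2|.
    by rewrite curry_imset2X -cardsX leq_imset_card.
  have [A10|[g1 g1A]] := set_0Vmem A1.
    by move: cJ; rewrite A10 cards0 leqn0 => /eqP->.
  have [A20|[g2 g2A]] := set_0Vmem A2.
    by move: cJ; rewrite A20 cards0 muln0 leqn0 => /eqP->.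
  have bijJ f1 f2 : f1 \in A1 -> f2 \in A2 -> _ := fun f1A f2A =>
    pbij_join dis (psupp_sub_dom sE1 f1A) (psupp_sub_dom sE2 f2A)
      (bijA _ (imset2_f _ f1A f2A)).
  have [_ _ cD] := bijJ _ _ g1A g2A.
  (* Pairing every member of [A1] with the same [g2] gives them all one domain and one range, as the
     induction hypothesis requires. *)
  have bij1 : {in A1, forall f, pbij (D :&: Defs.dom E1) (R :\: g2 @: (D :&: Defs.dom E2)) f}.
    by move=> f fA; case: (bijJ _ _ fA g2A).
  have bij2 : {in A2, forall f, pbij (D :&: Defs.dom E2) (R :\: g1 @: (D :&: Defs.dom E1)) f}.
    by move=> f fA; case: (bijJ _ _ g1A fA).
  have {IH1} IH1 := IH1 _ _ _ erefl bij1; have {IH2} IH2 := IH2 _ _ _ erefl bij2.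
  have c1 := card_pbij bij1; have c2 := card_pbij bij2.
  rewrite -cD; move: IH1 IH2 c1 c2 cJ.
  move: (#|D :&: Defs.dom E1|) (#|D :&: Defs.dom E2|) => d1 d2.
  move: #|[set pjoin f1 f2 | f1 in A1, f2 in A2]| #|A1| #|A2| => a a1 a2.
  move: (leaves E1) (leaves E2) => l1 l2 IH1 IH2 c1 c2 cJ.
  apply: leq_trans (_ : a1 * a2 * 2 ^ (d1 + d2) <= _); first by rewrite leq_mul2r cJ orbT.
  have bnd b1 b2 l e1 e2 : e2 <= e1 -> b1 * 2 ^ e1 <= 2 * l * e1`! ->
      b2 <= e2`! -> b1 * b2 * 2 ^ (e1 + e2) <= 2 * l * (e1 + e2)`!.
    move=> le21 le1 le2; rewrite expnD mulnACA.
    apply: leq_trans (leq_mul le1 (leq_mul le2 (leqnn _))) _.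
    by rewrite -mulnA leq_mul2l [_`! * (_ * _)]mulnA fact_add_exp2 ?orbT.
  have [le21|/ltnW le12] := leqP d2 d1.
    apply: leq_trans (bnd _ _ _ _ _ le21 IH1 c2) _.
    by rewrite leq_mul2r leq_mul2l leq_addr !orbT.
  rewrite [d1 + d2]addnC [a1 * a2]mulnC.
  apply: leq_trans (bnd _ _ _ _ _ le12 IH2 c1) _.
  by rewrite leq_mul2r leq_mul2l leq_addl !orbT.
Qed.

End LowerBound.

(** * Encoding length and the number of [n]-cycles *)

Lemma leaves_encode n (E : juexpr 'I_n 'I_n) : leaves E <= size (encode E).
Proof.
by elim: E => //= E1 IH1 E2 IH2; rewrite size_cat; lia.
Qed.

Lemma fcycle_ordS n : fcycle (@ordS n) (enum 'I_n).
Proof.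
case: n => [|n]; first by rewrite enum_ord0.
rewrite -(mono_cycle (f := val) (e := fun i j => ordS i == j)
  (e' := fun i j => i.+1 %% n.+1 == j)) // val_enum_ord /=.
apply/(pathP 0) => i; rewrite size_rcons size_iota ltnS => le_in.
rewrite nth_rcons size_iota -(rcons_cons 0) nth_rcons /= size_iota ltnS le_in.
have -> : nth 0 (0 :: iota 1 n) i = i by rewrite -[_ :: _]/(iota 0 n.+1) nth_iota.
have [lt_in|ge_in] := ltnP i n; first by rewrite nth_iota // add1n modn_small.
(* At the last index the successor wraps around to 0, the head of the enumeration. *)
have -> : i = n by apply/eqP; rewrite eqn_leq le_in.
by rewrite eqxx modnn.
Qed.

(** Conjugation by [t] relabels the cycle (0 1 ... n-1) through [t]. *)
Lemma is_ncycle_conj n (t : 'S_n) : is_ncycle (perm (@ordS_inj n) ^ t)%g.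
Proof.
apply/existsP; exists [tuple of map t (ord_tuple n)]; apply/andP; split.
  by rewrite map_inj_uniq ?val_ord_tuple ?enum_uniq //; apply: perm_inj.
rewrite /= cycle_map ?val_ord_tuple.
apply: sub_cycle (fcycle_ordS n) => i j /= /eqP <-.
by rewrite permJ permE.
Qed.

(* A permutation t is determined by its value at 0 and the conjugate by t of
   the standard cycle. *)
Lemma card_ncycles n : 0 < n -> n`! <= n * #|ncycles n|.
Proof.
case: n => // n _.
pose c := perm (@ordS_inj n.+1).
pose h (t : 'S_n.+1) : 'I_n.+1 * pfun 'I_n.+1 'I_n.+1 :=
  (t ord0, [ffun i => Some ((c ^ t)%g i)]).
have injh : injective h.
  move=> t u [tu0 /ffunP tuc]; apply/permP.
  have {}tuc i : (c ^ t)%g i = (c ^ u)%g i by have := tuc i; rewrite !ffunE => -[].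
  (* The conjugate sends [t k] to [t (k + 1)], so agreement at 0 propagates upwards. *)
  suff H k : forall lt_k : k < n.+1, t (Ordinal lt_k) = u (Ordinal lt_k).
    by case=> k lt_k; apply: H.
  elim: k => [|k IHk] lt_k; first by rewrite (_ : Ordinal _ = ord0) //; apply: val_inj.
  have -> : Ordinal lt_k = c (Ordinal (ltnW lt_k)).
    by apply: val_inj; rewrite permE /= modn_small.
  by rewrite -(permJ c t) tuc IHk permJ.
have -> : n.+1 * #|ncycles n.+1| = #|setX [set: 'I_n.+1] (ncycles n.+1)|.
  by rewrite cardsX cardsT card_ord.
rewrite -card_Sn -cardsT -(card_imset _ injh).
apply/subset_leq_card/subsetP => _ /imsetP[t _ ->]; rewrite !inE /=.
by apply/imsetP; exists (c ^ t)%g => //; rewrite inE is_ncycle_conj.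
Qed.

Lemma pbij_ncycles n : {in ncycles n, forall f, pbij setT (Some @: [set: 'I_n]) f}.
Proof.
move=> _ /imsetP[s _ ->]; apply/and3P; split.
- by apply/eqP/setP => i; rewrite !inE ffunE.
- apply/eqP/setP => -[i|]; apply/imsetP/imsetP => -[j _]; rewrite ?ffunE // => -[->].
    by exists (s j).
  by exists ((s^-1)%g j); rewrite // ffunE permKV.
- by rewrite card_imset //; apply: Some_inj.
Qed.

(** With N the number of [n]-cycles, [n! * 2 ^ n <= n * N * 2 ^ n <= 2 * n * leaves * n!]; cancel
    [n!] and use that every leaf costs at least one symbol. *)
Lemma ncycles_expr_size n (E : juexpr 'I_n 'I_n) : 0 < n ->
  sem E = Some (ncycles n) -> 2 ^ n <= 2 * n * size (encode E).
Proof.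
move=> n_gt0 semE; have := card_sem_pbij semE (@pbij_ncycles n).
rewrite cardsT card_ord => bnd.
rewrite -(leq_pmul2r (fact_gt0 n)).
have lb := card_ncycles n_gt0; have le := leaves_encode E.
apply: leq_trans (_ : n * (#|ncycles n| * 2 ^ n) <= _).
  by rewrite mulnC mulnA leq_mul2r lb orbT.
apply: leq_trans (leq_mul (leqnn n) bnd) _.
by rewrite [2 * n]mulnC -!mulnA !leq_mul2l leq_mul2r le !orbT.
Qed.

(** * Output length of a machine with bounded running time *)

Section TMOutput.
Variables (A : finType) (M : tm A).

(** Only a left move lengthens [cfg_right], and by one cell. *)
Lemma size_right_step (c c' : config M) : step c = Some c' ->
  size (cfg_right c') <= (size (cfg_right c)).+1.
Proof.
rewrite /step; case: (tm_delta _ _) => [[[q b] d]|] // [<-].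
by case: d => //=; rewrite size_behead; lia.
Qed.

Lemma size_right_run t (c c' : config M) : run t c = Some c' ->
  size (cfg_right c') <= size (cfg_right c) + t.
Proof.
elim: t c => [|t IHt] c /=; case sc: (step c) => [c1|] //.
- by case=> <-; rewrite addn0.
- by move=> /IHt; have := size_right_step sc; lia.
- by case=> <-; apply: leq_addr.
Qed.

Lemma size_output (c : config M) : size (output c) <= (size (cfg_right c)).+1.
Proof.
rewrite /output -[X in _ <= X]/(size (cfg_head c :: cfg_right c)).
by elim: (_ :: _) => //= -[[a|w]|] s IHs //=.
Qed.

Lemma size_output_run t (x : seq A) (c : config M) :
  run t (init M x) = Some c -> size (output c) <= (size x + t).+1.
Proof.
move=> /size_right_run /= le_c; apply: leq_trans (size_output c) _.
by move: le_c; rewrite size_behead size_map; lia.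
Qed.

End TMOutput.

(** * Polynomials against [2 ^ n] *)

Lemma poly_nat_bound (p : {poly nat}) :
  exists C d, forall n, p.[n]%R <= C * n.+1 ^ d.
Proof.
elim/poly_ind: p => [|p c [C [d IH]]]; first by exists 0, 0 => n; rewrite horner0.
exists (C + c), d.+1 => n; rewrite hornerMXaddC.
rewrite -[(_ + _)%R]/(p.[n]%R * n + c) mulnDl leq_add //.
  by rewrite expnSr mulnA leq_mul.
by rewrite leq_pmulr // expn_gt0.
Qed.

Lemma poly_lt_exp2 (p : {poly nat}) : exists2 n, 0 < n & p.[n]%R < 2 ^ n.
Proof.
have [C [d bnd]] := poly_nat_bound p.
(* As [n + 1 = 2 ^ (2 * k)], the bound [C * (n + 1) ^ d] is at most [2 ^ (C + 2 * k * d)]; since [k]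
   exceeds [C] and [2 * d], this exponent is below [(k + 1) ^ 2 <= 2 ^ (2 * k)]. *)
pose k := (C + 2 * d).+1; exists (2 ^ (2 * k)).-1.
  by rewrite -ltnS prednK ?expn_gt0 // -[1](expn0 2) ltn_exp2l.
apply: leq_ltn_trans (bnd _) _; rewrite prednK ?expn_gt0 // -expnM.
have ltC : C < 2 ^ C by apply: ltn_expl.
apply: (@leq_trans (2 ^ (C + 2 * k * d))).
  by rewrite expnD ltn_mul2r ltC expn_gt0.
rewrite leq_exp2l // -ltnS prednK ?expn_gt0 //.
have ltk : k < 2 ^ k by apply: ltn_expl.
rewrite [X in _ < 2 ^ X]mul2n -addnn expnD.
by apply: leq_trans (leq_mul ltk ltk); rewrite /k; nia.
Qed.

Theorem theorem2 :
  (exists (P : {poly nat}) (M : tm bool), forall n : nat,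
     exists2 c : config M,
       run P.[n]%R (init M (unary n)) = Some c &
       exists2 E : juexpr 'I_n 'I_n,
         output c = encode E & sem E = Some (ncycles n)) ->
  P_eq_NP.
Proof.
case=> P [M H].
(* On the unary input of length [n] the output has at most [n + P(n) + 1] symbols, so this
   polynomial bounds [2 * n * size (encode E)]. *)
have [n n_gt0] := poly_lt_exp2 ((2%:P * 'X) * ('X + P + 1%:P))%R.
rewrite !(hornerM, hornerD, hornerC, hornerX) ltnNge => /negP[].
have [c /size_output_run + [E outE semE]] := H n.
rewrite outE size_nseq => le_E.
apply: leq_trans (ncycles_expr_size n_gt0 semE) _.
rewrite -[X in _ <= X]/(2 * n * (n + P.[n]%R + 1)).
by rewrite leq_mul2l addn1 le_E orbT.
Qed.
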